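(* Let $X$ be a real Banach space and let $f_0,f_k:X\to\mathbb R\cup\{+\infty\}$ ($k\ge1$) be proper convex functions. Let $(\mathcal P)$ be the problem $\inf\{f_0(x): x\in X,\ f_k(x)\le0\ \forall k\ge1\}$, with $v(\mathcal P)<+\infty$. Put $f:=\sup_{k\ge1}f_k$, $f_\infty:=\limsup_{k\to\infty}f_k$ (pointwise), $C:=[f\le0]\cap[f_\infty\le0]\cap\operatorname{dom}f$, and consider the problems $$(\mathcal D)\quad \sup_{x^*\in X^*}\ -f_0^*(x^* )-\sigma_C(-x^* ),$$ $$(\mathcal D')\quad \sup_{x^*\in X^*}\ -f_0^*(x^* )-\min_{\alpha>0}\Big(\alpha\max\big\{\sup_{k\ge1}f_k^{**},\ f_\infty^{**},\ \mathrm I_{\overline{\operatorname{dom}f}^{w^{**}}}\big\}\Big)^*(-x^* ),$$ $$(\mathcal P_\infty^{**})\quad \inf\Big\{f_0^{**}(z): z\in X^{**},\ f_k^{**}(z)\le0\ \forall k\ge1,\ f_\infty^{**}(z)\le0,\ z\in\overline{\operatorname{dom}(f^{**})}^{w^{**}}\Big\}.$$ Suppose that $(\mathcal P)$ satisfies the Slater condition, i.e. there is $x_0\in\operatorname{dom}f_0$ with $\sup_{k\ge1}f_k(x_0)<0$. If $f$ is continuous at some point in $\operatorname{dom}f_0$, then $$v(\mathcal P)=v(\mathcal D)=v(\mathcal D')=v(\mathcal P_\infty^{**}).$$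
   Context: $X^*$ and $X^{**}$ are the dual and bidual of $X$, with $X\subset X^{**}$ canonically. $\operatorname{dom}h:=\{h<+\infty\}$; $[h\le0]:=\{x:h(x)\le0\}$; $\mathrm I_A$ is the indicator function of $A$ ($0$ on $A$, $+\infty$ outside); $\sigma_A(x^* ):=\sup_{x\in A}\langle x^*,x\rangle$. For $h:X\to\overline{\mathbb R}$: $h^*(x^* ):=\sup_{x\in X}(\langle x^*,x\rangle-h(x))$ for $x^*\in X^*$, and $h^{**}(z):=\sup_{x^*\in X^*}(\langle z,x^*\rangle-h^*(x^* ))$ for $z\in X^{**}$. In $(\mathcal D')$ the conjugated function $h$ is defined on $X^{**}$ and $h^*(x^* ):=\sup_{z\in X^{**}}(\langle z,x^*\rangle-h(z))$ for $x^*\in X^*$. $\overline{A}^{w^{**}}$ is the closure of $A\subset X^{**}$ in the weak-* topology $w^{**}=\sigma(X^{**},X^* )$. $v(\cdot)$ denotes the optimal value of an optimization problem (equal to $+\infty$ for an infeasible minimization problem). $f_\infty(x):=\limsup_{k\to\infty}f_k(x)$ is regarded in the paper as a function $X\to\mathbb R\cup\{+\infty\}$. *)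

(* Defs.v *)
From HB Require Import structures.
From mathcomp Require Import all_boot all_order all_algebra.
From mathcomp Require Import all_classical all_reals all_analysis.

Set Implicit Arguments.
Unset Strict Implicit.
Unset Printing Implicit Defensive.

Import Order.TTheory GRing.Theory Num.Theory.
Import numFieldNormedType.Exports.

Local Open Scope classical_set_scope.
Local Open Scope ring_scope.

Section Dual.
Context (R : realType) (X : normedModType R).

Definition dual_pred : {pred X -> R^o} :=
  fun f => `[< linear f /\ continuous f >].

Record dual : Type := MkDual { dual_fun : X -> R^o; _ : dual_fun \in dual_pred }.

HB.instance Definition _ := [isSub for dual_fun].
HB.instance Definition _ := [Choice of dual by <:].

Lemma dual_pred_submod : submod_closed dual_pred.
Proof.
split=> [|a f g].
  apply/asboolP; split; last exact: cst_continuous.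
  by move=> a x y; rewrite /GRing.zero /= scaler0 addr0.
move=> /asboolP[lf cf] /asboolP[lg cg]; apply/asboolP; split.
  move=> b x y; rewrite -[LHS]/(a * f (b *: x + y) + g (b *: x + y)) lf lg.
  rewrite -[RHS]/(b * (a * f x + g x) + (a * f y + g y)).
  rewrite -[X in a * (X + _)]/(b * f x).
  by rewrite -[X in _ + (X + _)]/(b * g x) !mulrDr (mulrCA a b) addrACA.
move=> x; apply: continuousD; last exact: cg.
by apply: continuousZ => //; [exact: cst_continuous | exact: cf].
Qed.

HB.instance Definition _ :=
  GRing.isSubmodClosed.Build R (X -> R^o) dual_pred dual_pred_submod.
HB.instance Definition _ := [SubChoice_isSubLmodule of dual by <:].

Coercion dual_fun : dual >-> Funclass.

Lemma dual_linear (f : dual) : linear (f : X -> R^o).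
Proof. by case: f => f /= /asboolP[]. Qed.

Lemma dual_continuous (f : dual) : continuous (f : X -> R^o).
Proof. by case: f => f /= /asboolP[]. Qed.

HB.instance Definition _ (f : dual) :=
  GRing.isLinear.Build R X R^o _ (f : X -> R^o) (dual_linear f).

Definition dual_norm (f : dual) : R :=
  sup [set `|f x| | x in [set x : X | `|x| <= 1]].

Lemma dual_norm_has_sup (f : dual) :
  has_sup [set `|f x| | x in [set x : X | `|x| <= 1]].
Proof.
split; first by exists `|f 0|; exists 0 => //=; rewrite normr0.
have /linear_bounded_continuous/bounded_funP/(_ 1)[M fM] := @dual_continuous f.
by exists M => _ [x /= x1 <-]; exact: fM.
Qed.

Lemma le_dual_norm (f : dual) (x : X) : `|f x| <= dual_norm f * `|x|.
Proof.
have [->|x0] := eqVneq x 0; first by rewrite linear0 !normr0 mulr0.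
rewrite -ler_pdivrMr ?normr_gt0//.
apply: (ub_le_sup (dual_norm_has_sup f).2) => /=.
exists (`|x|^-1 *: x) => /=.
  by rewrite normrZ normfV normr_id mulVf ?normr_eq0.
by rewrite linearZ /= normrM normfV normr_id mulrC.
Qed.

Lemma dual_norm_ge0 (f : dual) : 0 <= dual_norm f.
Proof.
apply: (le_trans (normr_ge0 (f 0))); apply: (ub_le_sup (dual_norm_has_sup f).2).
by exists 0 => //=; rewrite normr0.
Qed.

Lemma dual_norm_le (f : dual) (M : R) :
  (forall x, `|x| <= 1 -> `|f x| <= M) -> dual_norm f <= M.
Proof.
move=> fM; apply: ge_sup; first exact: (dual_norm_has_sup f).1.
by move=> _ [x /= x1 <-]; exact: fM.
Qed.

Lemma dual_normD (f g : dual) : dual_norm (f + g) <= dual_norm f + dual_norm g.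
Proof.
apply: dual_norm_le => x x1; apply: (le_trans (ler_normD _ _)); apply: lerD.
- by apply: (ub_le_sup (dual_norm_has_sup f).2); exists x.
- by apply: (ub_le_sup (dual_norm_has_sup g).2); exists x.
Qed.

Lemma dual_normZ (a : R) (f : dual) : dual_norm (a *: f) = `|a| * dual_norm f.
Proof.
have le b g : dual_norm (b *: g) <= `|b| * dual_norm g.
  apply: dual_norm_le => x x1.
  rewrite [X in `|X|](_ : _ = b * g x) // normrM ler_wpM2l//.
  by apply: (ub_le_sup (dual_norm_has_sup g).2); exists x.
apply/eqP; rewrite eq_le le /=; have [->|a0] := eqVneq a 0.
  by rewrite normr0 mul0r dual_norm_ge0.
rewrite -ler_pdivlMl ?normr_gt0// -normfV.
by rewrite -{1}[f](scalerK a0) le.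
Qed.

Lemma dual_norm0_eq0 (f : dual) : dual_norm f = 0 -> f = 0.
Proof.
move=> f0; apply/val_inj/funext => x /=.
by apply/normr0_eq0/eqP; rewrite eq_le normr_ge0 andbT -[leRHS](mul0r `|x|) -f0 le_dual_norm.
Qed.

HB.instance Definition _ :=
  Lmodule_isNormed.Build R dual dual_normD dual_normZ dual_norm0_eq0.

End Dual.

Arguments dual {R} X.

Section Bidual.
Context (R : realType) (X : normedModType R).

Lemma dual_eval_subproof (x : X) :
  ((fun xs : dual X => xs x) : dual X -> R^o) \in @dual_pred R (dual X).
Proof.
apply/asboolP.
have lin : linear ((fun xs : dual X => xs x) : dual X -> R^o) by [].
split=> //.
pose e : {linear dual X -> R^o} := HB.pack ((fun xs : dual X => xs x) : dual X -> R^o)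
  (GRing.isLinear.Build R (dual X) R^o _ _ lin).
apply: (@bounded_linear_continuous _ _ _ e); apply/bounded_funP => r.
exists (r * `|x|) => xs xsr; apply: (le_trans (le_dual_norm xs x)).
by rewrite ler_wpM2r.
Qed.

Definition bidual_embed (x : X) : dual (dual X) := MkDual (dual_eval_subproof x).

(* The initial topology of the inclusion of the dual into the product space of
   all functions X -> R is the weak-* topology, i.e. pointwise convergence. *)
Definition weak_star_closure (A : set (dual X)) : set (dual X) :=
  @closure
    (initial_topology
       (fun xs : dual X => (xs : X -> R^o) : prod_topology (fun _ : X => R^o)))
    A.

End Bidual.

Section Conjugation.
Context (R : realType).
Local Open Scope ereal_scope.

Definition edom (T : Type) (h : T -> \bar R) : set T := [set x | h x < +oo].

Definition proper_fun (T : Type) (h : T -> \bar R) : Prop :=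
  (forall x, -oo < h x) /\ edom h !=set0.

(* The product 0 * +oo is 0 here, so the endpoints t = 0, 1 are harmless. *)
Definition convex_efun (X : normedModType R) (h : X -> \bar R) : Prop :=
  forall (x y : X) (t : R), (0 <= t <= 1)%R ->
    h (t *: x + (1 - t) *: y)%R <= t%:E * h x + (1 - t)%:E * h y.

Definition indicator (T : Type) (A : set T) (x : T) : \bar R :=
  if x \in A then 0 else +oo.

Context (X : normedModType R).

Definition conjugate (h : X -> \bar R) (xs : dual X) : \bar R :=
  ereal_sup (range (fun x : X => (xs x)%:E - h x)).

Definition biconjugate (h : X -> \bar R) (z : dual (dual X)) : \bar R :=
  ereal_sup (range (fun xs : dual X => (z xs)%:E - conjugate h xs)).

(* Conjugation of functions on the bidual for its pairing with the dual: the
   result lives on the dual, not on the third dual. *)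
Definition bidual_conjugate (h : dual (dual X) -> \bar R) (xs : dual X) : \bar R :=
  ereal_sup (range (fun z : dual (dual X) => (z xs)%:E - h z)).

Definition support_fun (A : set X) (xs : dual X) : \bar R :=
  ereal_sup [set (xs x)%:E | x in A].

End Conjugation.

Section Problems.
Context (R : realType) (X : normedModType R) (f : nat -> X -> \bar R).
Local Open Scope ereal_scope.

Definition sup_constraint (x : X) : \bar R :=
  ereal_sup [set f k x | k in [set k | (1 <= k)%N]].

Definition limsup_constraint (x : X) : \bar R := limn_esup (fun k => f k x).

Definition primal_value : \bar R :=
  ereal_inf [set f 0%N x | x in [set x | forall k, (1 <= k)%N -> f k x <= 0]].

Definition feasible_core : set X :=
  [set x | sup_constraint x <= 0] `&` [set x | limsup_constraint x <= 0]
  `&` edom sup_constraint.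

Definition dual_value : \bar R :=
  ereal_sup (range (fun xs : dual X =>
    - conjugate (f 0%N) xs - support_fun feasible_core (- xs)%R)).

Definition bidual_max (z : dual (dual X)) : \bar R :=
  maxe (maxe (ereal_sup [set biconjugate (f k) z | k in [set k | (1 <= k)%N]])
             (biconjugate limsup_constraint z))
       (indicator R
          (weak_star_closure (@bidual_embed R X @` edom sup_constraint)) z).

Definition penalized_conjugate (xs : dual X) (a : R) : \bar R :=
  bidual_conjugate (fun z => a%:E * bidual_max z) xs.

Definition penalized_value (xs : dual X) : \bar R :=
  ereal_inf [set penalized_conjugate xs a | a in [set a | (0 < a)%R]].

Definition dual'_value : \bar R :=
  ereal_sup (range (fun xs : dual X =>
    - conjugate (f 0%N) xs - penalized_value (- xs)%R)).

Definition bidual_feasible : set (dual (dual X)) :=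
  [set z | (forall k, (1 <= k)%N -> biconjugate (f k) z <= 0) /\
           biconjugate limsup_constraint z <= 0 /\
           weak_star_closure (edom (biconjugate sup_constraint)) z].

Definition bidual_value : \bar R :=
  ereal_inf [set biconjugate (f 0%N) z | z in bidual_feasible].

End Problems.

(* Main.v *)
Require Import Defs.
From HB Require Import structures.
From mathcomp Require Import all_boot all_order all_algebra.
From mathcomp Require Import all_classical all_reals all_analysis.
From mathcomp Require Import ring lra.

(* The crux is an estimate on the bidual for the supremum f of the constraints:
   if u - c <= rho f on X, then z u - c <= rho K as soon as the biconjugates of
   all f_k and of their limsup are at most K at z and z lies in the weak-*
   closure of dom f. Write h_m for the supremum of the f_k with k > m, so that
   h_m = max (f_(m+1), h_(m+1)). Starting from q_0 = u - c, a two-function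
   multiplier rule and the sandwich theorem split off one constraint at a time:
   q_m = p_(m+1) + q_(m+1) with p_(m+1) <= (r_m - r_(m+1)) f_(m+1) and
   q_m <= r_m h_m. Since f is bounded above near a point x1, the slack
   r_m M - q_m(x1) is nonincreasing and dominates the norms of the slopes of the
   p_m, so the affine functions q_m converge in norm; their limit is at most (lim r_m)
   times the limsup, to which h_m decreases. Norm convergence is
   what allows evaluation at z in the bidual.

   The rest is duality: Fenchel duality on X gives (P) = (D), Lagrange
   multipliers under the Slater condition combined with the estimate turn the
   support function of the feasible set into the penalized conjugate, and the
   same estimate with K = 0 gives weak duality for the bidual problem. *)

Set Implicit Arguments.
Unset Strict Implicit.
Unset Printing Implicit Defensive.

Import Order.TTheory GRing.Theory Num.Theory.
Import numFieldNormedType.Exports.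

Local Open Scope classical_set_scope.
Local Open Scope ereal_scope.

(** * Hahn-Banach by minimal sublinear functionals *)

Section HahnBanach.
Context (R : realType) (V : lmodType R).
Local Open Scope ring_scope.

Definition sublinear (p : V -> R) : Prop :=
  (forall x y, p (x + y) <= p x + p y) /\
  (forall t x, 0 < t -> p (t *: x) <= t * p x).

Lemma sublinearZ (p : V -> R) (t : R) (x : V) :
  sublinear p -> 0 < t -> p (t *: x) = t * p x.
Proof.
move=> [_ ph] t0; apply/eqP; rewrite eq_le ph//=.
have := ph t^-1 (t *: x); rewrite invr_gt0 scalerA mulVf ?gt_eqF// scale1r.
by move=> /(_ t0); rewrite ler_pdivlMl.
Qed.

Lemma sublinear0 (p : V -> R) : sublinear p -> p 0 = 0.
Proof.
move=> sp; have := sublinearZ 0 sp (ltr0n R 2); rewrite scaler0 => h.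
by lra.
Qed.

Lemma sublinear_oppr (p : V -> R) (x : V) : sublinear p -> 0 <= p x + p (- x).
Proof. by move=> sp; rewrite -(sublinear0 sp) -(subrr x); apply: sp.1. Qed.

(* Subtracting the slope in direction y: for q minimal this cannot decrease q,
   which forces additivity. *)
Definition directional (q : V -> R) (y x : V) : R :=
  inf [set q (x + t *: y) - t * q y | t in [set t | 0 <= t]].

(** This bound makes the real [inf] in [directional] a genuine infimum, since [inf] takes a default
    value on sets unbounded below. *)
Lemma directional_lb (q : V -> R) (x y : V) : sublinear q ->
  lbound [set q (x + t *: y) - t * q y | t in [set t | 0 <= t]] (- q (- x)).
Proof.
move=> sq _ [t /= t0 <-].
have : q (t *: y) <= q (x + t *: y) + q (- x).
  by rewrite -[in leLHS](addrK x (t *: y)) [t *: y + x]addrC; apply: sq.1.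
have [->|tn0] := eqVneq t 0.
  by rewrite scale0r addr0 mul0r (sublinear0 sq) => h; lra.
by rewrite (sublinearZ y sq) ?lt0r ?tn0// => h; lra.
Qed.

Lemma directional_le (q : V -> R) (x y : V) (t : R) : sublinear q -> 0 <= t ->
  directional q y x <= q (x + t *: y) - t * q y.
Proof.
move=> sq t0; apply: ge_inf; last by exists t.
by exists (- q (- x)); exact: directional_lb.
Qed.

Lemma le_directional (q : V -> R) (x y : V) (c : R) :
  (forall t, 0 <= t -> c <= q (x + t *: y) - t * q y) -> c <= directional q y x.
Proof.
move=> h; apply: lb_le_inf; last by move=> _ [t /= t0 <-]; exact: h.
by exists (q (x + 0 *: y) - 0 * q y); exists 0 => /=.
Qed.

Lemma directional_sublinear (q : V -> R) (y : V) :
  sublinear q -> sublinear (directional q y).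
Proof.
move=> sq; split=> [x1 x2|a x a0].
  rewrite -lerBlDl; apply: le_directional => t2 t20.
  rewrite lerBlDl -lerBlDr; apply: le_directional => t1 t10.
  have := directional_le (x1 + x2) y sq (addr_ge0 t10 t20).
  have := sq.1 (x1 + t1 *: y) (x2 + t2 *: y).
  by rewrite scalerDl addrACA => h1 h2; lra.
rewrite -ler_pdivrMl//; apply: le_directional => t t0.
rewrite ler_pdivrMl//.
have := directional_le (a *: x) y sq (mulr_ge0 (ltW a0) t0).
by rewrite -scalerA -scalerDr (sublinearZ _ sq a0) => h; lra.
Qed.

Lemma minimal_sublinear_additive (q : V -> R) : sublinear q ->
  (forall q', sublinear q' -> (forall x, q' x <= q x) -> q' = q) ->
  forall x y, q (x + y) = q x + q y.
Proof.
move=> sq qmin x y; apply/eqP; rewrite eq_le sq.1/=.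
have <- : directional q y x = q x.
  rewrite (qmin _ (directional_sublinear y sq))// => x'.
  by have := directional_le x' y sq (lexx 0); rewrite scale0r addr0 mul0r subr0.
by have := directional_le x y sq ler01; rewrite scale1r mul1r => h; lra.
Qed.

Lemma minimal_sublinear_linear (q : V -> R) : sublinear q ->
  (forall q', sublinear q' -> (forall x, q' x <= q x) -> q' = q) ->
  linear (q : V -> R^o).
Proof.
move=> sq qmin; have qD := minimal_sublinear_additive sq qmin.
have qN x : q (- x) = - q x.
  by have := qD x (- x); rewrite subrr (sublinear0 sq) => h; lra.
move=> a x y; rewrite qD; congr (_ + _).
have [a0|a0|->] := ltgtP a 0; last by rewrite scale0r (sublinear0 sq) scale0r.
  rewrite -[a in LHS]opprK scaleNr qN (sublinearZ _ sq) ?oppr_gt0//.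
  by rewrite mulNr opprK.
by rewrite (sublinearZ _ sq).
Qed.

(** Zorn's lemma on the sublinear functionals below p: a chain is bounded by its pointwise infimum,
    and a minimal functional is linear. *)
Theorem hahn_banach (p : V -> R) : sublinear p ->
  exists l : V -> R, linear (l : V -> R^o) /\ forall x, l x <= p x.
Proof.
move=> sp.
pose D (q : V -> R) := sublinear q /\ forall x, q x <= p x.
pose T := sig D.
pose above (q q' : T) : bool := `[< forall x, sval q' x <= sval q x >].
have [] := @Zorn T above.
- by move=> q; apply/asboolP.
- move=> q1 q2 q3 /asboolP h1 /asboolP h2; apply/asboolP => x.
  exact: le_trans (h2 x) (h1 x).
- move=> [q1 h1] [q2 h2] /asboolP/= h12 /asboolP/= h21.
  apply: eq_exist; apply/funext => x; apply/eqP.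
  by rewrite eq_le h12 h21.
- move=> A Atot.
  have [[q0 Aq0]|A0] := pselect (A !=set0); last first.
    have hp : D p by split.
    by exists (exist D p hp) => q Aq; case: A0; exists q.
  pose E x : set R := [set sval q x | q in A].
  have Elb x : lbound (E x) (- p (- x)).
    move=> _ [q Aq <-]; have [sq qp] := svalP q.
    by have := sublinear_oppr x sq; have := qp (- x); lra.
  have infE q x : A q -> inf (E x) <= sval q x.
    by move=> Aq; apply: ge_inf; [exists (- p (- x))|exists q].
  have Einf x c : (forall q, A q -> c <= sval q x) -> c <= inf (E x).
    move=> h; apply: lb_le_inf; first by exists (sval q0 x); exists q0.
    by move=> _ [q Aq <-]; exact: h.
  have hm : D (fun x => inf (E x)).
    split; last by move=> x; exact: le_trans (infE q0 x Aq0) ((svalP q0).2 x).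
    split=> [x y|t x t0].
      rewrite -lerBlDl; apply: (Einf) => q2 Aq2.
      rewrite lerBlDl -lerBlDr; apply: (Einf) => q1 Aq1; rewrite lerBlDr.
      have [/asboolP h|/asboolP h] := Atot _ _ Aq1 Aq2.
        apply: (le_trans (infE _ _ Aq2)); apply: (le_trans ((svalP q2).1.1 _ _)).
        by rewrite lerD2r.
      apply: (le_trans (infE _ _ Aq1)); apply: (le_trans ((svalP q1).1.1 _ _)).
      by rewrite lerD2l.
    rewrite -ler_pdivrMl//; apply: (Einf) => q Aq; rewrite ler_pdivrMl//.
    exact: le_trans (infE _ _ Aq) ((svalP q).1.2 _ _ t0).
  exists (exist D _ hm) => q Aq; apply/asboolP => x /=; exact: infE.
move=> [q [sq qp]] qmin; exists q; split=> //.
apply: minimal_sublinear_linear => // q' sq' q'q.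
have hq' : D q'.
  by split=> // x; exact: le_trans (q'q x) (qp x).
have := qmin (exist D q' hq'); rewrite /above/= => /(_ _)/(congr1 sval) /=; apply.
exact/asboolP.
Qed.

End HahnBanach.

(** * Sandwich theorem and multiplier rule *)

Section Sandwich.
Context (R : realType) (X : normedModType R).
Local Open Scope ring_scope.

(** Convexity of a subset of X x R; epigraphs and hypographs are treated alike, without arithmetic
    on infinite values. *)
Definition convex_rel (A : X -> R -> Prop) : Prop :=
  forall x y r s t, 0 <= t <= 1 -> A x r -> A y s ->
    A (t *: x + (1 - t) *: y) (t * r + (1 - t) * s).

Lemma dual_of_linear (l : X -> R) (K : R) :
  linear (l : X -> R^o) -> (forall x, l x <= K * `|x|) ->
  exists u : dual X, forall x, u x = l x.
Proof.
move=> lin lK.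
pose e : {linear X -> R^o} := HB.pack (l : X -> R^o)
  (GRing.isLinear.Build R X R^o _ _ lin).
have bnd x : `|l x| <= K * `|x|.
  rewrite ler_norml lK andbT lerNl.
  by have := lK (- x); rewrite normrN -[l (- x)]/(e (- x)) linearN.
have ed : (l : X -> R^o) \in @dual_pred R X.
  apply/asboolP; split=> //.
  apply: (@bounded_linear_continuous _ _ _ e); apply/bounded_funP => r.
  exists (`|K| * r) => x xr; apply: (le_trans (bnd x)).
  by apply: (le_trans (ler_wpM2r _ (ler_norm K))) => //; rewrite ler_wpM2l.
by exists (MkDual ed).
Qed.

Section gap.
Variables (A B : X -> R -> Prop) (x1 : X) (M b e : R).
Hypotheses (cA : convex_rel A) (cB : convex_rel B).
Hypothesis BA : forall x r s, A x r -> B x s -> s <= r.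
Hypotheses (e0 : 0 < e) (ball_A : forall x, `|x - x1| < e -> A x M) (Bx1 : B x1 b).

(** The convex cone generated by the difference of A and B in X x R; a linear functional below its
    lower boundary [gap] separates A from B. *)
Definition gap_set (d : X) : set R :=
  [set g | exists t x y r s, [/\ 0 < t, A x r, B y s & d = t *: (x - y)]
                             /\ g = t * (r - s)].

Definition gap (d : X) : R := inf (gap_set d).

Lemma gap_setD d d' g g' :
  gap_set d g -> gap_set d' g' -> gap_set (d + d') (g + g').
Proof.
move=> [t [x [y [r [s [[t0 Ax By ->] ->]]]]]].
move=> [t' [x' [y' [r' [s' [[t0' Ax' By' ->] ->]]]]]].
have T0 : 0 < t + t' by rewrite addr_gt0.
pose c := t / (t + t').
have c01 : 0 <= c <= 1.
  by rewrite divr_ge0 /= ?(ltW t0, ltW T0)// ler_pdivrMr// mul1r lerDl ltW.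
have c1 : (t + t') * c = t by rewrite /c mulrC divfK ?gt_eqF.
have c2 : (t + t') * (1 - c) = t' by rewrite mulrBr c1 mulr1 addrAC subrr add0r.
exists (t + t'), (c *: x + (1 - c) *: x'), (c *: y + (1 - c) *: y').
exists (c * r + (1 - c) * r'), (c * s + (1 - c) * s').
split; [split=> //|].
- exact: cA.
- exact: cB.
- have -> : c *: x + (1 - c) *: x' - (c *: y + (1 - c) *: y')
            = c *: (x - y) + (1 - c) *: (x' - y').
    by rewrite !scalerBr opprD addrACA.
  by rewrite [RHS]scalerDr !scalerA c1 c2.
by rewrite -[in LHS]c2 -[X in X * (r - s)]c1; ring.
Qed.

Lemma gap_set0 g : gap_set 0 g -> 0 <= g.
Proof.
move=> [t [x [y [r [s [[t0 Ax By xy0] ->]]]]]].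
move: xy0 => /esym/eqP; rewrite scaler_eq0 gt_eqF//= subr_eq0 => /eqP xy.
by rewrite pmulr_rge0// subr_ge0; apply: (BA Ax); rewrite xy.
Qed.

Lemma gap_setZ t d g : 0 < t -> gap_set d g -> gap_set (t *: d) (t * g).
Proof.
move=> t0 [t' [x [y [r [s [[t0' Ax By ->] ->]]]]]].
exists (t * t'), x, y, r, s; split; last by rewrite mulrA.
by split; rewrite ?mulr_gt0// scalerA.
Qed.

(** The dilation factor 2 |d| / e places a point at distance e / 2 from x1, where A holds at height
    M. The bound makes linear functionals below [gap] continuous. *)
Lemma gap_set_norm d : d != 0 -> gap_set d (2 / e * (M - b) * `|d|).
Proof.
move=> d0; have nd : 0 < `|d| by rewrite normr_gt0.
have T0 : 0 < 2 / e * `|d| by rewrite !mulr_gt0// invr_gt0.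
exists (2 / e * `|d|), (x1 + (2 / e * `|d|)^-1 *: d), x1, M, b.
split; last by rewrite mulrAC.
split=> //; last by rewrite addrAC subrr add0r scalerA divff ?gt_eqF// scale1r.
apply: ball_A; rewrite addrAC subrr add0r normrZ normfV (gtr0_norm T0).
rewrite ltr_pdivrMl// mulrAC divfK ?gt_eqF//.
by rewrite ltr_pMl// ltr1n.
Qed.

Lemma gap_set_neq0 d : gap_set d !=set0.
Proof.
have [->|d0] := eqVneq d 0; last by eexists; exact: gap_set_norm.
exists (1 * (M - b)), 1, x1, x1, M, b; split=> //; split=> //.
  by apply: ball_A; rewrite subrr normr0.
by rewrite subrr scaler0.
Qed.

Lemma gap_le d g : gap_set d g -> gap d <= g.
Proof.
(* A height over - d added to one over d is a height over 0, hence nonnegative; so [gap_set d] is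
   bounded below. *)
move=> dg; apply: ge_inf => //; have [g' dg'] := gap_set_neq0 (- d).
exists (- g') => h dh; rewrite lerNl -subr_ge0 opprK addrC.
by apply: gap_set0; rewrite -(subrr d); exact: gap_setD.
Qed.

Lemma gap_sublinear : sublinear gap.
Proof.
split=> [d d'|t d t0].
  rewrite -lerBlDl; apply: lb_le_inf (gap_set_neq0 _) _ => g' dg'.
  rewrite lerBlDl -lerBlDr; apply: lb_le_inf (gap_set_neq0 _) _ => g dg.
  by rewrite lerBlDr; apply: gap_le; exact: gap_setD.
rewrite -ler_pdivrMl//; apply: lb_le_inf (gap_set_neq0 _) _ => g dg.
by rewrite ler_pdivrMl//; apply: gap_le; exact: gap_setZ.
Qed.

(** Hahn-Banach below [gap] gives the slope u, and c is the infimum of u y - s over B. *)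
Lemma sandwich : exists (u : dual X) (c : R),
  (forall x r, A x r -> u x - c <= r) /\ (forall x s, B x s -> s <= u x - c).
Proof.
have [l [lin lgap]] := hahn_banach gap_sublinear.
have [u ul] : exists u : dual X, forall x, u x = l x.
  apply: (dual_of_linear (K := 2 / e * (M - b)) lin) => x.
  have [->|x0] := eqVneq x 0; last exact: le_trans (lgap x) (gap_le (gap_set_norm x0)).
  by rewrite normr0 mulr0 -(sublinear0 gap_sublinear).
have AB x r y s : A x r -> B y s -> u x - r <= u y - s.
  move=> Ax By; suff : u x - u y <= r - s by lra.
  rewrite [X in X <= _](_ : _ = l (x - y)); last by rewrite -ul linearB.
  apply: (le_trans (lgap _)); apply: gap_le.
  by exists 1, x, y, r, s; rewrite scale1r mul1r.
exists u, (inf [set g | exists y s, B y s /\ g = u y - s]); split=> [x r Ax|y s By].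
  rewrite lerBlDr -lerBlDl; apply: lb_le_inf; first by exists (u x1 - b), x1, b.
  by move=> _ [y [s [By ->]]]; exact: AB.
rewrite lerBrDl -lerBrDr; apply: ge_inf; last by exists y, s.
exists (u x1 - M) => _ [y' [s' [By' ->]]]; apply: AB => //.
by apply: ball_A; rewrite subrr normr0.
Qed.

End gap.
End Sandwich.

Section Multiplier.
Context (R : realType).
Local Open Scope ring_scope.

(* A convex set missing the open negative quadrant lies above a line through 0. *)
Lemma max_multiplier (Q : R -> R -> Prop) :
  (forall r s r' s' t, 0 <= t <= 1 -> Q r s -> Q r' s' ->
    Q (t * r + (1 - t) * r') (t * s + (1 - t) * s')) ->
  (forall r s, Q r s -> 0 <= r \/ 0 <= s) ->
  exists2 a : R, 0 <= a <= 1 & forall r s, Q r s -> 0 <= a * r + (1 - a) * s.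
Proof.
move=> cQ Qmax.
(* Otherwise the segment joining the two points meets the diagonal inside the open negative
   quadrant, at weight (s' - r') / D. *)
have cross r s r' s' : Q r s -> Q r' s' -> s < 0 -> r' < 0 -> s * r' <= s' * r.
  move=> Q1 Q2 s0 r0'.
  have r0 : 0 <= r by case: (Qmax _ _ Q1) => // h; lra.
  have s0' : 0 <= s' by case: (Qmax _ _ Q2) => // h; lra.
  rewrite leNgt; apply/negP => lt.
  pose D := (s' - r') + (r - s).
  have D0 : 0 < D by rewrite /D; lra.
  have t01 : 0 <= (s' - r') / D <= 1.
    apply/andP; split; last by rewrite ler_pdivrMr// /D; lra.
    by apply: divr_ge0; [lra|exact: ltW].
  have Di : D / D = 1 by rewrite divff// gt_eqF.
  have e1 : 1 - (s' - r') / D = (r - s) / D.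
    by rewrite -Di -mulrBl; congr (_ / _); rewrite /D; ring.
  have := Qmax _ _ (cQ _ _ _ _ _ t01 Q1 Q2); rewrite e1.
  rewrite [X in 0 <= X \/ _](_ : _ = (s' * r - s * r') / D); last by ring.
  rewrite [X in _ \/ 0 <= X](_ : _ = (s' * r - s * r') / D); last by ring.
  by rewrite !pmulr_lge0 ?invr_gt0//; case=> h; lra.
(* A point with s < 0 requires a >= - s / (r - s), one with r < 0 requires a <= s / (s - r). By
   [cross] these are compatible, so the supremum of the lower bounds works. *)
pose L : set R := [set g | g = 0 \/ exists r s, [/\ Q r s, s < 0 & g = - s / (r - s)]].
have Lub c : 0 <= c -> (forall r s, Q r s -> s < 0 -> - s / (r - s) <= c) ->
    ubound L c.
  by move=> c0 h _ [->//|[r [s [Q1 s0 ->]]]]; exact: h.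
have L1 : ubound L 1.
  apply: Lub => // r s Q1 s0.
  have r0 : 0 <= r by case: (Qmax _ _ Q1) => // h; lra.
  by rewrite ler_pdivrMr; lra.
have L0 : L 0 by left.
exists (sup L).
  rewrite ub_le_sup//=; last by exists 1.
  by apply: ge_sup => //; exists 0.
move=> r s Q1; have a01 : 0 <= sup L <= 1.
  rewrite ub_le_sup//=; last by exists 1.
  by apply: ge_sup => //; exists 0.
have [r0|r0] := ltP r 0.
  have s0 : 0 <= s by case: (Qmax _ _ Q1) => // h; lra.
  have : sup L <= s / (s - r).
    apply: ge_sup; first by exists 0.
    apply: Lub => [|r' s' Q2 s0']; first by rewrite divr_ge0//; lra.
    have r0' : 0 <= r' by case: (Qmax _ _ Q2) => // h; lra.
    have h := cross _ _ _ _ Q2 Q1 s0' r0.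
    rewrite ler_pdivrMr; last by lra.
    rewrite mulrAC ler_pdivlMr; last by lra.
    by nra.
  by rewrite ler_pdivlMr; [nra|lra].
have [s0|s0] := ltP s 0; last by nra.
have : - s / (r - s) <= sup L.
  apply: ub_le_sup; first by exists 1.
  by right; exists r, s.
by rewrite ler_pdivrMr; [nra|lra].
Qed.

End Multiplier.

(** * Affine minorants and the bidual *)

Section Minorants.
Context (R : realType) (X : normedModType R).

Definition epigraph (F : X -> \bar R) (x : X) (r : R) : Prop := F x <= r%:E.

(* For lam = 0 this says that u - c is nonpositive on the domain of F. *)
Definition minorizes (F : X -> \bar R) (u : dual X) (c lam : R) : Prop :=
  forall x r, F x <= r%:E -> (u x - c <= lam * r)%R.

Lemma epigraph_convex (F : X -> \bar R) :
  convex_efun F -> convex_rel (epigraph F).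
Proof.
move=> cF x y r s t t01 Fx Fy; have /andP[t0 t1] := t01.
apply: (le_trans (cF x y t t01)).
rewrite [leRHS](_ : _ = t%:E * r%:E + (1 - t)%:E * s%:E)//.
by apply: leeD; apply: lee_wpmul2l => //; rewrite lee_fin// subr_ge0.
Qed.

Lemma lty_fin_ub (y : \bar R) : y < +oo -> exists r : R, y <= r%:E.
Proof.
by case: y => [r _|//|_]; [exists r | exists 0%R; rewrite leNye].
Qed.

(** By hypothesis u - c is at most rho times the maximum of F and G. The multiplier rule replaces
    the maximum by a convex combination with weight a; then w - d is sandwiched between u - c - (1 -
    a) rho G and a rho F. *)
Lemma minorizes_split (F G : X -> \bar R) (x1 : X) (M e : R)
    (u : dual X) (c rho : R) :
  convex_rel (epigraph F) -> convex_rel (epigraph G) ->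
  (0 < e)%R -> (forall x, (`|x - x1| < e)%R -> F x <= M%:E) ->
  G x1 <= M%:E -> (0 <= rho)%R ->
  (forall x r, F x <= r%:E -> G x <= r%:E -> (u x - c <= rho * r)%R) ->
  exists (u' : dual X) (c' rho' : R),
    [/\ (0 <= rho' <= rho)%R, minorizes G u' c' rho' &
        minorizes F (u - u')%R (c - c')%R (rho - rho')%R].
Proof.
move=> cF cG e0 FM GM rho0 uFG.
pose Q (g h : R) := exists x r s, [/\ F x <= r%:E, G x <= s%:E,
  g = (rho * r - (u x - c))%R & h = (rho * s - (u x - c))%R].
have [||a /andP[a0 a1] Qa] := @max_multiplier R Q.
- move=> _ _ _ _ t t01 [x [r [s [Fx Gx -> ->]]]] [y [r' [s' [Fy Gy -> ->]]]].
  exists (t *: x + (1 - t) *: y)%R, (t * r + (1 - t) * r')%R, (t * s + (1 - t) * s')%R.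
  have ul : u (t *: x + (1 - t) *: y)%R = (t * u x + (1 - t) * u y)%R.
    by rewrite linearD !linearZ.
  by split; [exact: cF|exact: cG|rewrite ul; ring|rewrite ul; ring].
- move=> _ _ [x [r [s [Fx Gx -> ->]]]]; rewrite !subr_ge0.
  have [rs|/ltW sr] := leP r s; [right|left]; apply: uFG => //.
    by apply: le_trans Fx _; rewrite lee_fin.
  by apply: le_trans Gx _; rewrite lee_fin.
pose A (x : X) (g : R) := exists2 r, F x <= r%:E & g = (a * rho * r)%R.
pose B (x : X) (h : R) :=
  exists2 s, G x <= s%:E & h = (u x - c - (1 - a) * rho * s)%R.
have [||||||w [d [wA wB]]] := @sandwich R X A B x1 (a * rho * M)%R
    (u x1 - c - (1 - a) * rho * M)%R e.
- move=> x y _ _ t t01 [r Fx ->] [r' Fy ->].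
  by exists (t * r + (1 - t) * r')%R; [exact: cF|ring].
- move=> x y _ _ t t01 [r Fx ->] [r' Fy ->].
  exists (t * r + (1 - t) * r')%R; first exact: cG.
  have -> : u (t *: x + (1 - t) *: y)%R = (t * u x + (1 - t) * u y)%R.
    by rewrite linearD !linearZ.
  by ring.
- move=> x _ _ [r Fx ->] [s Gx ->].
  have /Qa : Q (rho * r - (u x - c))%R (rho * s - (u x - c))%R by exists x, r, s.
  by move=> h; lra.
- exact: e0.
- by move=> x /FM Fx; exists M.
- by exists M.
exists (u - w)%R, (c - d)%R, ((1 - a) * rho)%R; split.
- by apply/andP; split; nra.
- move=> x s Gx; have : B x (u x - c - (1 - a) * rho * s)%R by exists s.
  move=> /wB h; rewrite [X in (X - _)%R](_ : _ = (u x - w x)%R)//.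
  by lra.
- rewrite !subKr => x r Fx.
  have -> : (rho - (1 - a) * rho = a * rho)%R by ring.
  by apply: wA; exists r.
Qed.

(** Dividing by lam shows that the conjugate of F at u / lam is at most c / lam; this slope is one
    competitor in the biconjugate at z. *)
Lemma biconjugate_minorant_gt0 (F : X -> \bar R) (u : dual X) (c lam K : R)
    (z : dual (dual X)) :
  (0 < lam)%R -> minorizes F u c lam -> biconjugate F z <= K%:E ->
  (z u - c <= lam * K)%R.
Proof.
move=> lam0 uF FK.
have conj_le : conjugate F (lam^-1 *: u)%R <= (c / lam)%:E.
  apply: ge_ereal_sup => _ [x _ <-].
  rewrite [X in X%:E - _](_ : _ = u x / lam)%R; last by rewrite mulrC.
  have := uF x; case: (F x) => [r|_|].
  - move=> /(_ r (lexx _)) h.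
    rewrite -EFinB lee_fin lerBlDr ler_pdivrMr//.
    by rewrite mulrDl divfK ?gt_eqF//; lra.
  - by rewrite addeNy leNye.
  (* The value -oo is impossible: u x - c would lie below lam r for every real r. *)
  - move=> /(_ ((u x - c) / lam - 1)%R (leNye _)) h.
    exfalso; move: h; rewrite mulrBr mulr1 mulrC divfK ?gt_eqF// => h; lra.
have : (z (lam^-1 *: u)%R)%:E - (c / lam)%:E <= K%:E.
  apply: le_trans FK; apply: (@le_trans _ _ ((z (lam^-1 *: u)%R)%:E
    - conjugate F (lam^-1 *: u)%R)); first exact: leeB.
  by apply: ereal_sup_ubound; exists (lam^-1 *: u)%R.
rewrite linearZ -EFinB lee_fin => h.
have : (lam^-1 * z u - c / lam <= K)%R by exact: h.
by rewrite [(c / lam)%R]mulrC -mulrBr ler_pdivrMl.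
Qed.

(** For lam = 0 one cannot divide, but then u is at most c on D and the half-space hypothesis
    carries this bound over to z. *)
Lemma biconjugate_minorant (F : X -> \bar R) (D : set X)
    (u : dual X) (c lam K : R) (z : dual (dual X)) :
  (0 <= lam)%R -> minorizes F u c lam -> D `<=` edom F ->
  (forall (v : dual X) t, (forall x, D x -> v x <= t)%R -> (z v <= t)%R) ->
  biconjugate F z <= K%:E -> (z u - c <= lam * K)%R.
Proof.
rewrite le_eqVlt => /predU1P[<- uF DF zD _|lam0 uF _ _]; last first.
  exact: biconjugate_minorant_gt0.
rewrite mul0r subr_le0; apply: zD => x /DF/lty_fin_ub[r Fx].
by have := uF _ _ Fx; rewrite mul0r subr_le0.
Qed.

(** Since v n x + delta n |x| is nonincreasing, v converges pointwise; the remainder bound (delta m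
    - lim delta) |x| upgrades this to norm convergence. *)
Lemma dual_cvg_of_monotone (v : nat -> dual X) (delta : nat -> R) :
  (forall n, (0 <= delta n)%R) ->
  (forall m n, (m <= n)%N -> (delta n <= delta m)%R) ->
  (forall m n x, (m <= n)%N -> (v m x - v n x <= (delta m - delta n) * `|x|)%R) ->
  exists w : dual X, v n @[n --> \oo] --> w.
Proof.
move=> d0 dmono vd.
pose dl := limn delta.
have dcvg : delta n @[n --> \oo] --> dl.
  apply: nonincreasing_is_cvgn => [m n /dmono//|].
  by exists 0%R => _ [n _ <-].
have dld n : (dl <= delta n)%R.
  by apply: nonincreasing_cvgn_ge => [i j /dmono//|]; apply/cvg_ex; exists dl.
have vN m n (x : X) : (m <= n)%N -> (v n x - v m x <= (delta m - delta n) * `|x|)%R.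
  by move=> mn; have := vd _ _ (- x)%R mn; rewrite normrN !linearN/= => h; lra.
have vcvg (x : X) : exists l : R, v n x @[n --> \oo] --> l.
  have : cvgn (fun n => (v n x + delta n * `|x|)%R : R).
    apply: nonincreasing_is_cvgn => [m n mn|]; first by have := vN _ _ x mn; lra.
    exists (v 0%N x - delta 0%N * `|x|)%R => _ [n _ <-].
    have := vd _ _ x (leq0n n); have := mulr_ge0 (d0 n) (normr_ge0 x).
    by move=> h1 h2; lra.
  move=> /cvg_ex[/= l lP]; exists (l - dl * `|x|)%R.
  have -> : (fun n => v n x) = (fun n => (v n x + delta n * `|x|) - delta n * `|x|)%R.
    by apply/funext => n; rewrite addrK.
  by apply: cvgB lP _; apply: cvgMr_tmp.
have [l lP] := choice vcvg.
have wd m x : (`|l x - v m x| <= (delta m - dl) * `|x|)%R.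
  have h1 : (`|v n x - v m x|)%R @[n --> \oo] --> (`|l x - v m x|)%R.
    by apply: cvg_norm; apply: cvgB => //; exact: cvg_cst.
  have h2 : ((delta m - delta n) * `|x|)%R @[n --> \oo] --> ((delta m - dl) * `|x|)%R.
    by apply: cvgMr_tmp; apply: cvgB => //; exact: cvg_cst.
  apply: ler_cvg_to h1 h2 _; near=> n.
  have mn : (m <= n)%N by near: n; exact: nbhs_infty_ge.
  by rewrite ler_norml; have := vN _ _ x mn; have := vd _ _ x mn => p1 p2; lra.
have llin : linear (l : X -> R^o).
  move=> a x y; apply: (cvg_unique (@norm_hausdorff R R^o) (lP (a *: x + y)%R)) => /=.
  have -> : (fun n => v n (a *: x + y)%R) = (fun n => a * v n x + v n y)%R.
    by apply/funext => n; rewrite linearP.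
  by apply: cvgD => //; apply: cvgMl_tmp.
have [w wl] : exists w : dual X, forall x, w x = l x.
  apply: (@dual_of_linear _ _ _ (dual_norm (v 0%N) + (delta 0%N - dl))%R) => // x.
  have := le_trans (ler_norm _) (le_dual_norm (v 0%N) x).
  have := le_trans (ler_norm _) (wd 0%N x).
  by rewrite mulrDl => h1 h2; lra.
exists w; apply/cvgrPdist_le => eps eps0.
have /cvgrPdist_le/(_ _ eps0) := dcvg; apply: filterS => n dn.
apply: dual_norm_le => x x1.
rewrite [X in `|X|%R](_ : _ = (l x - v n x)%R); last by rewrite -wl.
apply: (le_trans (wd n x)).
have dn' : (delta n - dl <= eps)%R.
  by apply: le_trans dn; rewrite distrC; exact: ler_norm.
by apply: le_trans dn'; rewrite ler_piMr// subr_ge0.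
Unshelve. all: by end_near. Qed.

End Minorants.

(** * Minorants of a supremum and of the limsup *)

Section LimsupMinorant.
Context (R : realType) (X : normedModType R) (f : nat -> X -> \bar R).

(** With the strict inequality, [tail_sup 0] is convertible to [sup_constraint], and [tail_sup m] is
    the maximum of [f m.+1] and [tail_sup m.+1]. *)
Definition tail_sup (m : nat) (x : X) : \bar R :=
  ereal_sup [set f k x | k in [set k | (m < k)%N]].

Lemma tail_sup_leP (m : nat) (x : X) (y : \bar R) :
  tail_sup m x <= y <-> forall k, (m < k)%N -> f k x <= y.
Proof.
split=> [h k mk|h]; last by apply: ge_ereal_sup => _ [k /= mk <-]; exact: h.
by apply: le_trans h; apply: ereal_sup_ubound; exists k.
Qed.

Lemma tail_sup_homo (m n : nat) (x : X) : (m <= n)%N -> tail_sup n x <= tail_sup m x.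
Proof.
move=> mn; apply/tail_sup_leP => k nk.
by have /tail_sup_leP := lexx (tail_sup m x); apply; exact: leq_ltn_trans nk.
Qed.

Lemma limsup_constraintE (x : X) :
  limsup_constraint f x = ereal_inf (range (esups (f ^~ x))).
Proof. by rewrite /limsup_constraint limn_esup_lim; apply/cvg_lim => //; exact: cvg_esups_inf. Qed.

Lemma limsup_constraint_lt (x : X) (y : \bar R) :
  limsup_constraint f x < y -> exists m, tail_sup m x <= y.
Proof.
rewrite limsup_constraintE => /ereal_inf_lt[_ [m _ <-] /ltW my].
exists m; apply: le_trans my; apply/tail_sup_leP => k mk.
by apply: ereal_sup_ubound; exists k => //=; exact: ltnW.
Qed.

Lemma limsup_constraint_le (x : X) : limsup_constraint f x <= sup_constraint f x.
Proof.
(* Index 1 leaves out the objective [f 0]. *)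
rewrite limsup_constraintE; apply: (@le_trans _ _ (esups (f ^~ x) 1%N)).
  by apply: ereal_inf_lbound; exists 1%N.
by apply: ge_ereal_sup => _ [k /= k1 <-]; apply: ereal_sup_ubound; exists k.
Qed.

Hypothesis f_convex : forall k, convex_efun (f k).

Lemma tail_sup_convex (m : nat) : convex_rel (epigraph (tail_sup m)).
Proof.
move=> x y r s t t01 /tail_sup_leP fx /tail_sup_leP fy; apply/tail_sup_leP => k mk.
by apply: (epigraph_convex (f_convex k) t01); [exact: fx|exact: fy].
Qed.

Variables (x1 : X) (M e : R).
Hypothesis e0 : (0 < e)%R.
Hypothesis sup_le : forall x, (`|x - x1| < e)%R -> sup_constraint f x <= M%:E.

Let f_le x k : (`|x - x1| < e)%R -> (0 < k)%N -> f k x <= M%:E.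
Proof. by move=> /sup_le/(tail_sup_leP 0)/(_ k). Qed.

Let x1_ball : (`|x1 - x1| < e)%R.
Proof. by rewrite subrr normr0. Qed.

(** Iterates [minorizes_split], with [f m.+1] as F and [tail_sup m.+1] as G, on triples of slope,
    constant and multiplier. *)
Lemma tail_minorants (u : dual X) (c rho : R) :
  (0 <= rho)%R -> minorizes (sup_constraint f) u c rho ->
  exists (v : nat -> dual X) (t r : nat -> R),
    [/\ v 0%N = u, t 0%N = c & r 0%N = rho] /\
    forall m, [/\ (0 <= r m.+1 <= r m)%R, minorizes (tail_sup m) (v m) (t m) (r m) &
      minorizes (f m.+1) (v m - v m.+1)%R (t m - t m.+1)%R (r m - r m.+1)%R].
Proof.
move=> rho0 u_minor.
pose inv m (p : dual X * R * R) :=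
  (0 <= p.2)%R /\ minorizes (tail_sup m) p.1.1 p.1.2 p.2.
pose next m (p p' : dual X * R * R) := [/\ (0 <= p'.2 <= p.2)%R,
  minorizes (tail_sup m.+1) p'.1.1 p'.1.2 p'.2 &
  minorizes (f m.+1) (p.1.1 - p'.1.1)%R (p.1.2 - p'.1.2)%R (p.2 - p'.2)%R].
have step (mp : nat * (dual X * R * R)) :
    exists p', inv mp.1 mp.2 -> next mp.1 mp.2 p'.
  case: mp => m [[w d] l] /=.
  have [[/= l0 w_minor]|ninv] := pselect (inv m (w, d, l)); last by exists (w, d, l).
  have [|||x r Fx Gx|w' [d' [l' [l'P w'G w'F]]]] :=
      @minorizes_split _ _ (f m.+1) (tail_sup m.+1) x1 M e w d l
        (epigraph_convex (f_convex _)) (@tail_sup_convex _) e0.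
  - by move=> x xe; exact: f_le.
  - by apply/tail_sup_leP => k mk; apply: f_le => //; exact: leq_ltn_trans mk.
  - exact: l0.
  - apply: w_minor; apply/tail_sup_leP => k; rewrite leq_eqVlt => /predU1P[<-//|mk].
    by move/tail_sup_leP: Gx; exact.
  - by exists (w', d', l').
have [g gP] := choice step.
pose fix p m := if m is n.+1 then g (n, p n) else (u, c, rho).
have pinv m : inv m (p m).
  elim: m => [//|m /(gP (m, p m))[/= /andP[l0 _] wG _]]; by split.
exists (fun m => (p m).1.1), (fun m => (p m).1.2), (fun m => (p m).2).
split=> // m; have [/= lP wG wF] := gP (m, p m) (pinv m).
by split=> //; exact: (pinv m).2.
Qed.

(** As F is at most M on the ball, moving from x1 by e / 2 along y raises w by at most the slack l M
    - (w x1 - d). *)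
Lemma minorizes_opball (F : X -> \bar R) (w : dual X) (d l : R) (y : X) :
  (forall x, (`|x - x1| < e)%R -> F x <= M%:E) -> minorizes F w d l ->
  (w y <= (l * M - (w x1 - d)) * (2 / e) * `|y|)%R.
Proof.
move=> FM wF.
have [->|y0] := eqVneq y 0%R; first by rewrite linear0 normr0 mulr0.
have ny : (0 < `|y|)%R by rewrite normr_gt0.
pose a := (e / 2 / `|y|)%R.
have a0 : (0 < a)%R by rewrite /a !divr_gt0.
have := wF (x1 + a *: y)%R M; rewrite linearD linearZ/=.
have -> : ((l * M - (w x1 - d)) * (2 / e) * `|y| = a^-1 * (l * M - (w x1 - d)))%R.
  by rewrite /a !invfM !invrK; ring.
rewrite ler_pdivlMl// => h.
have : (w x1 + a * w y - d <= l * M)%R.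
  apply: h; apply: FM; rewrite addrAC subrr add0r normrZ (gtr0_norm a0).
  by rewrite /a divfK ?gt_eqF// ltr_pdivrMr// ltr_pMr// ltr1n.
by move=> h1; lra.
Qed.

Lemma limsup_minorant (u : dual X) (c rho : R) :
  (0 <= rho)%R -> minorizes (sup_constraint f) u c rho ->
  exists (v : nat -> dual X) (t r : nat -> R) (w : dual X) (d l : R),
    [/\ v 0%N = u, t 0%N = c & r 0%N = rho] /\
    [/\ v n @[n --> \oo] --> w, t n @[n --> \oo] --> d, r n @[n --> \oo] --> l,
      (0 <= l)%R & minorizes (limsup_constraint f) w d l] /\
    forall m, (r m.+1 <= r m)%R /\
      minorizes (f m.+1) (v m - v m.+1)%R (t m - t m.+1)%R (r m - r m.+1)%R.
Proof.
move=> rho0 /(tail_minorants rho0)[v [t [r [init vtr]]]].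
exists v, t, r.
have r0 m : (0 <= r m)%R by have [/andP[h1 h2] _ _] := vtr m; exact: le_trans h2.
have rmono m n : (m <= n)%N -> (r n <= r m)%R.
  move=> mn; rewrite -(subnKC mn); elim: (n - m)%N => [|k]; first by rewrite addn0.
  by apply: le_trans; rewrite addnS; have [/andP[]] := vtr (m + k)%N.
pose slack m := (r m * M - (v m x1 - t m))%R.
have slack0 m : (0 <= slack m)%R.
  have [_ h _] := vtr m; rewrite subr_ge0; apply: h.
  by apply/tail_sup_leP => k mk; apply: f_le => //; exact: leq_ltn_trans mk.
have vslack m y : (v m y - v m.+1 y <= (slack m - slack m.+1) * (2 / e) * `|y|)%R.
  have [_ _ h] := vtr m.
  have fM x : (`|x - x1| < e)%R -> f m.+1 x <= M%:E by move=> xe; exact: f_le.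
  have := minorizes_opball y fM h.
  rewrite [((v m - v m.+1)%R : dual X) y](_ : _ = (v m y - v m.+1 y)%R)//.
  rewrite [((v m - v m.+1)%R : dual X) x1](_ : _ = (v m x1 - v m.+1 x1)%R)//.
  by congr (_ <= _ * _ * _)%R; rewrite /slack; ring.
have slackS m : (slack m.+1 <= slack m)%R.
  have [_ _ h] := vtr m; have := h x1 M (f_le x1_ball (ltn0Sn m)).
  rewrite [((v m - v m.+1)%R : dual X) x1](_ : _ = (v m x1 - v m.+1 x1)%R)//.
  by rewrite /slack => h1; lra.
pose delta m := (slack m * (2 / e))%R.
have e2 : (0 < 2 / e)%R by rewrite divr_gt0.
have slack_mono m n : (m <= n)%N -> (slack n <= slack m)%R.
  move=> mn; rewrite -(subnKC mn); elim: (n - m)%N => [|k]; first by rewrite addn0.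
  by apply: le_trans; rewrite addnS.
have [||| w vw] := @dual_cvg_of_monotone _ _ v delta.
- by move=> n; rewrite mulr_ge0// ltW.
- by move=> m n mn; rewrite ler_pM2r//; exact: slack_mono.
- move=> m n y mn; rewrite -(subnKC mn); elim: (n - m)%N => [|k IH].
    by rewrite addn0 !subrr mul0r.
  have := vslack (m + k)%N y; rewrite addnS => h.
  have -> : (v m y - v (m + k).+1 y =
    (v m y - v (m + k)%N y) + (v (m + k)%N y - v (m + k).+1 y))%R by ring.
  apply: le_trans (lerD IH h) _; rewrite le_eqVlt; apply/orP; left; apply/eqP.
  by rewrite /delta; ring.
have [l rl] : exists l : R, r n @[n --> \oo] --> l.
  exists (limn r); apply: nonincreasing_is_cvgn => [m n /rmono//|].
  by exists 0%R => _ [n _ <-].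
have [g gg] : exists g : R, slack n @[n --> \oo] --> g.
  exists (limn slack); apply: nonincreasing_is_cvgn => [m n /slack_mono//|].
  by exists 0%R => _ [n _ <-].
have vx x : v n x @[n --> \oo] --> w x.
  exact: (cvg_comp _ _ vw (@dual_continuous _ _ (bidual_embed x) w)).
(* The constants t have no evident monotonicity; they converge because v n x1, the slack and r
   do. *)
have tE : t = (fun n => v n x1 + slack n - r n * M)%R.
  by apply/funext => n; rewrite /slack; ring.
pose d := (w x1 + g - l * M)%R.
have td : t n @[n --> \oo] --> d.
  by rewrite tE; apply: cvgB; [apply: cvgD|apply: cvgMr_tmp].
have l0 : (0 <= l)%R.
  by apply: ler_cvg_to (cvg_cst _) rl _; near=> n; exact: r0.
exists w, d, l; split=> //; split; last first.
  by move=> m; have [/andP[]] := vtr m.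
split=> // x y fxy; apply/ler_addgt0Pr => eps eps0.
(* The margin h turns the limsup bound into a bound on some tail; the divisor l + 1 covers l = 0. *)
pose h := (eps / (l + 1))%R.
have h0 : (0 < h)%R by rewrite divr_gt0// ltr_wpDl.
have lh : (l * h <= eps)%R.
  by rewrite /h mulrA ler_pdivrMr ?ltr_wpDl//; nra.
have [|m fm] := @limsup_constraint_lt x (y + h)%:E.
  by apply: le_lt_trans fxy _; rewrite lte_fin ltrDl.
apply: (@le_trans _ _ (l * (y + h))%R); last by rewrite mulrDr lerD2l.
have lhs : (v n x - t n)%R @[n --> \oo] --> (w x - d)%R by exact: cvgB.
have rhs : (r n * (y + h))%R @[n --> \oo] --> (l * (y + h))%R by exact: cvgMr_tmp.
apply: ler_cvg_to lhs rhs _; near=> n.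
have [_ nP _] := vtr n; apply: nP; apply: le_trans fm.
by apply: tail_sup_homo; near: n; exact: nbhs_infty_ge.
Unshelve. all: by end_near. Qed.

End LimsupMinorant.

(** * Estimates at points of the bidual *)

Section BidualBounds.
Context (R : realType) (X : normedModType R).

(** Evaluation at x is weak-* continuous, so the half-space it defines is weak-* closed. *)
Lemma weak_star_closure_le (A : set (dual X)) (x : X) (t : R) :
  (forall z, A z -> z x <= t)%R -> forall z, weak_star_closure A z -> (z x <= t)%R.
Proof.
move=> At z Az.
pose T := initial_topology
  (fun xs : dual X => (xs : X -> R^o) : prod_topology (fun _ : X => R^o)).
have eval_cont : continuous (fun xs : T => (xs : dual X) x : R^o).
  move=> xs; apply: (@continuous_comp _ _ _
    (fun xs : T => (xs : X -> R^o) : prod_topology (fun _ : X => R^o)) (proj x)).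
    exact: initial_continuous.
  exact: proj_continuous.
have cl : closed [set xs : T | ((xs : dual X) x <= t)%R].
  apply: (closed_comp (f := fun xs : T => (xs : dual X) x : R^o) (D := [set r | (r <= t)%R])).
    by move=> xs _; exact: eval_cont.
  exact: closed_le.
have := @closureS T A _ At z Az.
by rewrite -((closure_id _).1 cl).
Qed.

Lemma weak_star_closure_sub (A : set (dual X)) : A `<=` weak_star_closure A.
Proof.
pose T := initial_topology
  (fun xs : dual X => (xs : X -> R^o) : prod_topology (fun _ : X => R^o)).
exact: (@subset_closure T A).
Qed.

Lemma biconjugate_embed_le (F : X -> \bar R) (x : X) :
  biconjugate F (bidual_embed x) <= F x.
Proof.
apply: ge_ereal_sup => _ [u _ <-].
have : (u x)%:E - F x <= conjugate F u by apply: ereal_sup_ubound; exists x.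
rewrite [dual_fun (bidual_embed x) u](_ : _ = u x)//.
case: (F x) => [r||]; last 2 first.
- by rewrite leey.
- by rewrite /= addey// leye_eq => /eqP ->.
case: (conjugate F u) => [s||]; rewrite ?leNye//.
by rewrite -!EFinB !lee_fin => h; lra.
Qed.

End BidualBounds.

Section Constraints.
Context (R : realType) (X : normedModType R) (f : nat -> X -> \bar R).
Hypothesis f_convex : forall k, convex_efun (f k).
Variables (x1 : X) (M e : R).
Hypothesis e0 : (0 < e)%R.
Hypothesis sup_le : forall x, (`|x - x1| < e)%R -> sup_constraint f x <= M%:E.

(** The pieces split off by [limsup_minorant] are estimated at z one by one and telescoped, their
    limit by the limsup. The half-space hypothesis on z serves zero multipliers; it is the common
    consequence of the closure conditions in (D') and in the bidual problem. *)
Lemma bidual_minorant (u : dual X) (c rho K : R) (z : dual (dual X)) :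
  (0 <= rho)%R -> minorizes (sup_constraint f) u c rho ->
  (forall (v : dual X) t,
    (forall x, edom (sup_constraint f) x -> v x <= t)%R -> (z v <= t)%R) ->
  (forall k, (1 <= k)%N -> biconjugate (f k) z <= K%:E) ->
  biconjugate (limsup_constraint f) z <= K%:E ->
  (z u - c <= rho * K)%R.
Proof.
move=> rho0 u_minor zD fK infK.
have [v [t [r [w [d [l [[<- <- <-] [[vw td rl l0 w_minor] vtr]]]]]]]] :=
  limsup_minorant f_convex e0 sup_le rho0 u_minor.
have zw : (z w - d <= l * K)%R.
  apply: (biconjugate_minorant l0 w_minor _ zD infK) => x.
  exact: le_lt_trans (limsup_constraint_le f x).
have zv m : (z (v 0%N) - t 0%N <= (r 0%N - r m) * K + (z (v m) - t m))%R.
  elim: m => [|m IH]; first by rewrite subrr mul0r add0r.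
  have [rm vm] := vtr m.
  have : (z (v m - v m.+1)%R - (t m - t m.+1) <= (r m - r m.+1) * K)%R.
    apply: (biconjugate_minorant _ vm _ zD (fK _ _)) => //; first by rewrite subr_ge0.
    by move=> x; apply: le_lt_trans; apply: ereal_sup_ubound; exists m.+1.
  by rewrite linearB => h; move: h IH; rewrite /= => h IH; lra.
have zvw : z (v n) @[n --> \oo] --> z w.
  exact: (cvg_comp _ _ vw (@dual_continuous _ _ z w)).
have lim : ((r 0%N - r n) * K + (z (v n) - t n))%R @[n --> \oo] -->
    ((r 0%N - l) * K + (z w - d))%R.
  apply: cvgD; last exact: cvgB.
  by apply: cvgMr_tmp; apply: cvgB => //; exact: cvg_cst.
have : (z (v 0%N) - t 0%N <= (r 0%N - l) * K + (z w - d))%R.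
  by apply: ler_cvg_to (cvg_cst _) lim _; near=> n; exact: zv.
by move=> h; lra.
Unshelve. all: by end_near. Qed.

(* The domain of the biconjugate lies in every weak-* closed half-space
   containing dom f: otherwise adding large multiples of its normal to the slope
   of an affine minorant of f makes the biconjugate infinite. *)
Lemma edom_biconjugate_le (u v : dual X) (c t : R) (F : X -> \bar R) :
  minorizes F u c 1 -> (forall x, edom F x -> v x <= t)%R ->
  forall z, edom (biconjugate F) z -> (z v <= t)%R.
Proof.
move=> uF vt z /lty_fin_ub[K zK]; rewrite leNgt; apply/negP => tz.
have bound a : (0 <= a)%R -> (z u + a * z v - (c + a * t) <= K)%R.
  move=> a0; pose w : dual X := (u + a *: v)%R.
  have wF : minorizes F w (c + a * t)%R 1.
    move=> x r Fx; have := uF x r Fx.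
    have := vt x (le_lt_trans Fx (ltry r)).
    rewrite [w x](_ : _ = u x + a * v x)%R// => h1 h2.
    by have := ler_wpM2l a0 h1; lra.
  have := biconjugate_minorant_gt0 ltr01 wF zK.
  by rewrite mul1r /w linearD linearZ.
have tz0 : (0 < z v - t)%R by rewrite subr_gt0.
(* This value makes a (z v - t) exceed K + c - z u, against [bound]. *)
pose a := ((`|K + c - z u| + 1) / (z v - t))%R.
have a0 : (0 <= a)%R by apply: divr_ge0; [exact: addr_ge0|exact: ltW].
have := bound a a0; have : (a * (z v - t) = `|K + c - z u| + 1)%R.
  by rewrite /a divfK// gt_eqF.
have := ler_norm (K + c - z u)%R.
by clear zK; rewrite mulrBr => h1 h2 h3; lra.
Qed.

End Constraints.

(** * Slater condition and penalization *)

Section SlaterPoint.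
Context (R : realType) (X : normedModType R) (f : nat -> X -> \bar R).

Lemma sup_constraint_ball (x1 : X) :
  sup_constraint f x1 \is a fin_num -> {for x1, continuous (sup_constraint f)} ->
  exists (M e : R), (0 < e)%R /\
    forall x, (`|x - x1| < e)%R -> sup_constraint f x <= M%:E.
Proof.
move=> fin cont; pose M := (fine (sup_constraint f x1) + 1)%R.
have lt : sup_constraint f x1 < M%:E.
  by rewrite -[ltLHS]fineK// lte_fin ltrDl.
have /nbhs_normP[e /= e0 eM] := cont _ (open_ereal_lt' lt).
exists M, e; split=> // x xe; apply: ltW.
by apply: (eM x); rewrite /= distrC.
Qed.

Hypothesis f_convex : forall k, convex_efun (f k).
Variables (x0 x1 : X) (M e : R).
Hypothesis e0 : (0 < e)%R.
Hypothesis sup_le : forall x, (`|x - x1| < e)%R -> sup_constraint f x <= M%:E.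
Hypothesis slater : sup_constraint f x0 < 0.

Lemma slater_ub : exists2 s : R, (s < 0)%R & sup_constraint f x0 <= s%:E.
Proof.
move: slater; case: (sup_constraint f x0) => [r|//|_]; first by exists r.
by exists (-1)%R; rewrite ?leNye// ltrN10.
Qed.

(** By convexity, the ball around x1 contracted towards x0 with a small ratio t is a ball on which f
    is nonpositive. *)
Lemma slater_ball : edom (f 0%N) x0 -> edom (f 0%N) x1 ->
  exists (x2 : X) (d : R), [/\ (0 < d)%R, edom (f 0%N) x2 &
    forall x, (`|x - x2| < d)%R -> sup_constraint f x <= 0].
Proof.
move=> /lty_fin_ub[y0 fx0] /lty_fin_ub[y1 fx1].
have [s s0 fs] := slater_ub.
have D0 : (0 < `|M| + 1 - s)%R by have := normr_ge0 M => h; lra.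
(* Chosen so that t M + (1 - t) s <= 0; |M| + 1 keeps the denominator positive for either sign of
   M. *)
pose t := (- s / (`|M| + 1 - s))%R.
have t0 : (0 < t)%R by rewrite /t divr_gt0// oppr_gt0.
have t01 : (0 <= t <= 1)%R.
  rewrite ltW//= /t ler_pdivrMr//; have := normr_ge0 M => h; lra.
exists (t *: x1 + (1 - t) *: x0)%R, (t * e)%R; split.
- by rewrite mulr_gt0.
- apply: le_lt_trans (ltry (t * y1 + (1 - t) * y0)%R).
  exact: (epigraph_convex (f_convex 0%N) t01 fx1 fx0).
(* x' is the point of the ball around x1 that the contraction sends to x. *)
move=> x xd; pose x' := (x1 + t^-1 *: (x - (t *: x1 + (1 - t) *: x0)))%R.
have -> : x = (t *: x' + (1 - t) *: x0)%R.
  rewrite /x' scalerDr scalerA divff ?gt_eqF// scale1r.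
  by rewrite addrAC addrC subrK.
have x'M : sup_constraint f x' <= M%:E.
  apply: sup_le; rewrite /x' addrAC subrr add0r normrZ normfV (gtr0_norm t0).
  by rewrite ltr_pdivrMl.
apply: le_trans (tail_sup_convex f_convex t01 x'M fs) _.
rewrite lee_fin; have -> : (t * M + (1 - t) * s = s * (`|M| + 1 - M) / (`|M| + 1 - s))%R.
  by rewrite /t; field; rewrite gt_eqF.
rewrite pmulr_lle0 ?invr_gt0// nmulr_rle0//.
by have := ler_norm M => h; lra.
Qed.

(** A Lagrange multiplier for maximizing y under f <= 0: [max_multiplier] on the pairs (c - y x, h)
    with f x <= h gives weights a and 1 - a, whence l = (1 - a) / a. *)
Lemma support_multiplier (y : dual X) (c : R) :
  support_fun (feasible_core f) y = c%:E ->
  exists2 l : R, (0 <= l)%R & minorizes (sup_constraint f) y c l.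
Proof.
move=> yc.
have yle x : sup_constraint f x <= 0 -> (y x <= c)%R.
  move=> fx; rewrite -lee_fin -yc; apply: ereal_sup_ubound; exists x => //.
  split; first by split=> //; apply: le_trans (limsup_constraint_le f x) fx.
  exact: le_lt_trans fx (ltry 0).
pose Q (g h : R) := exists2 x, sup_constraint f x <= h%:E & g = (c - y x)%R.
have [||a /andP[a0 a1] Qa] := @max_multiplier R Q.
- move=> _ h _ h' t t01 [x fx ->] [x' fx' ->].
  exists (t *: x + (1 - t) *: x')%R; first exact: (tail_sup_convex f_convex t01).
  have -> : y (t *: x + (1 - t) *: x')%R = (t * y x + (1 - t) * y x')%R.
    by rewrite linearD !linearZ.
  by ring.
- move=> _ h [x fx ->]; have [h0|h0] := leP 0%R h; [by right|left].
  rewrite subr_ge0; apply: yle; apply: le_trans fx _.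
  by rewrite lee_fin ltW.
have [s s0 fs] := slater_ub.
(* For a = 0 the Slater point would give 0 <= s < 0. *)
have apos : (0 < a)%R.
  rewrite lt0r a0 andbT; apply/eqP => az.
  have /Qa : Q (c - y x0)%R s by exists x0.
  by rewrite az mul0r add0r subr0 mul1r leNgt s0.
exists ((1 - a) / a)%R; first by apply: divr_ge0 => //; rewrite subr_ge0.
move=> x r fx; have /Qa h : Q (c - y x)%R r by exists x.
rewrite mulrAC ler_pdivlMr//.
by lra.
Qed.

End SlaterPoint.

Section Penalization.
Context (R : realType) (X : normedModType R) (f : nat -> X -> \bar R).

Lemma bidual_max_ge0 (z : dual (dual X)) : 0 <= bidual_max f z.
Proof.
rewrite /bidual_max le_max; apply/orP; right.
by rewrite /indicator; case: ifP.
Qed.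

Lemma bidual_max_embed (x : X) :
  sup_constraint f x <= 0 -> bidual_max f (bidual_embed x) <= 0.
Proof.
move=> fx; rewrite /bidual_max !ge_max -!andbA; apply/and3P; split.
- apply: ge_ereal_sup => _ [k /= k1 <-].
  apply: le_trans (biconjugate_embed_le _ _) _.
  by apply: le_trans fx; apply: ereal_sup_ubound; exists k.
- apply: le_trans (biconjugate_embed_le _ _) _.
  exact: le_trans (limsup_constraint_le f x) fx.
- rewrite /indicator ifT// inE; apply: weak_star_closure_sub.
  by exists x => //; exact: le_lt_trans fx (ltry 0).
Qed.

(** Among the competitors in the penalized supremum are the images of feasible points, where the
    penalty is nonpositive. *)
Lemma support_le_penalized (y : dual X) (a : R) : (0 < a)%R ->
  support_fun (feasible_core f) y <= penalized_conjugate f y a.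
Proof.
move=> a0; apply: ge_ereal_sup => _ [x [[fx _] _] <-].
apply: (@le_trans _ _ ((bidual_embed x y)%:E - a%:E * bidual_max f (bidual_embed x))).
  rewrite -[leLHS]sube0; apply: leeB => //.
  by apply: mule_ge0_le0; [rewrite lee_fin ltW|exact: bidual_max_embed].
by apply: ereal_sup_ubound; exists (bidual_embed x).
Qed.

Hypothesis f_convex : forall k, convex_efun (f k).
Variables (x0 x1 : X) (M e : R).
Hypothesis e0 : (0 < e)%R.
Hypothesis sup_le : forall x, (`|x - x1| < e)%R -> sup_constraint f x <= M%:E.
Hypothesis slater : sup_constraint f x0 < 0.

Lemma feasible_core_slater : feasible_core f x0.
Proof.
split; last exact: lt_trans slater (ltry 0).
by split; [exact: ltW|exact: le_trans (limsup_constraint_le f x0) (ltW slater)].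
Qed.

Lemma support_gtNy (y : dual X) : -oo < support_fun (feasible_core f) y.
Proof.
apply: (@lt_le_trans _ _ (y x0)%:E); first exact: ltNyr.
by apply: ereal_sup_ubound; exists x0 => //; exact: feasible_core_slater.
Qed.

Lemma penalized_attained (y : dual X) :
  exists2 a : R, (0 < a)%R &
    penalized_conjugate f y a = support_fun (feasible_core f) y.
Proof.
suff [a a0 ha] : exists2 a : R, (0 < a)%R &
    penalized_conjugate f y a <= support_fun (feasible_core f) y.
  by exists a => //; apply/eqP; rewrite eq_le ha support_le_penalized.
have := support_gtNy y.
case yc : (support_fun (feasible_core f) y) => [c||] //; last first.
  by exists 1%R; rewrite ?leey.
move=> _; have [l l0 l_minor] := support_multiplier f_convex slater yc.
(* l may vanish but the penalty factor must be positive; l + 1 serves because [bidual_max] is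
   nonnegative. It also keeps an infinite [bidual_max] infinite, where 0 times +oo would be 0. *)
exists (l + 1)%R; first by rewrite ltr_wpDl.
apply: ge_ereal_sup => _ [z _ <-].
have := bidual_max_ge0 z.
case zK : (bidual_max f z) => [K||] //; last first.
  rewrite gt0_muley ?lte_fin ?ltr_wpDl//.
  by rewrite addeNy leNye.
rewrite lee_fin => K0; rewrite -EFinM -EFinB lee_fin.
have : bidual_max f z <= K%:E by rewrite zK.
rewrite /bidual_max !ge_max -andbA => /and3P[supK limK indK].
have zcl : weak_star_closure (@bidual_embed R X @` edom (sup_constraint f)) z.
  by move: indK; rewrite /indicator; case: ifPn => [|_]; [rewrite inE|rewrite leye_eq].
have : (z y - c <= l * K)%R.
  apply: (bidual_minorant f_convex e0 sup_le l0 l_minor _ _ limK).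
    move=> v t vt; apply: weak_star_closure_le zcl => _ [x fx <-].
    exact: vt.
  by move=> k k1; apply: le_trans supK; apply: ereal_sup_ubound; exists k.
by move=> h; lra.
Qed.

Lemma penalized_valueE (y : dual X) :
  penalized_value f y = support_fun (feasible_core f) y.
Proof.
have [a a0 ya] := penalized_attained y; apply/eqP; rewrite eq_le; apply/andP; split.
  by rewrite -ya; apply: ereal_inf_lbound; exists a.
by apply: le_ereal_inf_tmp => _ [b b0 <-]; exact: support_le_penalized.
Qed.

Hypothesis x1_fin : sup_constraint f x1 \is a fin_num.

(** Sandwiching the single point (x1, f x1) below the epigraph gives an affine function supporting f
    at x1, as [edom_biconjugate_le] needs. *)
Lemma sup_constraint_minorant :
  exists (u : dual X) (c : R), minorizes (sup_constraint f) u c 1.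
Proof.
pose A := epigraph (sup_constraint f).
pose B (x : X) (s : R) := x = x1 /\ s = fine (sup_constraint f x1).
have [|||//|||u [c [uA _]]] := @sandwich R X A B x1 M (fine (sup_constraint f x1)) e.
- exact: (@tail_sup_convex _ _ _ f_convex 0).
- move=> x y r s t _ [-> ->] [-> ->]; split; last by ring.
  by rewrite -scalerDl addrC subrK scale1r.
- by move=> x r s Ar [xx1 ->]; rewrite -lee_fin fineK// -xx1.
- exact: sup_le.
- by [].
by exists u, c => x r /uA; rewrite mul1r.
Qed.

(** With c the support function at - u, [bidual_minorant] for K = 0 gives - z u <= c at feasible z;
    the biconjugate of [f 0] at z is at least z u minus the conjugate at u. *)
Lemma dual_le_bidual : dual_value f <= bidual_value f.
Proof.
apply: le_ereal_inf_tmp => _ [z [zk [zinf zcl]] <-].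
apply: ge_ereal_sup => _ [u _ <-].
have := support_gtNy (- u)%R.
case uc : (support_fun (feasible_core f) (- u)%R) => [c||] //; last first.
  by rewrite /= addeNy leNye.
move=> _; have [l l0 l_minor] := support_multiplier f_convex slater uc.
have [v [d v_minor]] := sup_constraint_minorant.
have : (z (- u) - c <= l * 0)%R.
  apply: (bidual_minorant f_convex e0 sup_le l0 l_minor _ zk zinf) => w t wt.
  apply: weak_star_closure_le zcl => z'.
  exact: edom_biconjugate_le v_minor wt _.
rewrite linearN mulr0 /= => h.
have : (z u)%:E - conjugate (f 0%N) u <= biconjugate (f 0%N) z.
  by apply: ereal_sup_ubound; exists u.
apply: le_trans; rewrite addeC; apply: leeB => //.
by rewrite lee_fin; lra.
Qed.

End Penalization.

(** * Comparison of the optimal values *)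

Section Values.
Context (R : realType) (X : normedModType R) (f : nat -> X -> \bar R).

Lemma bidual_le_primal : bidual_value f <= primal_value f.
Proof.
apply: le_ereal_inf_tmp => _ [x xk <-].
have fx : sup_constraint f x <= 0 by apply: ge_ereal_sup => _ [k /= k1 <-]; exact: xk.
apply: le_trans (biconjugate_embed_le _ _).
apply: ereal_inf_lbound; exists (bidual_embed x) => //; split; [|split].
- by move=> k /xk; apply: le_trans; exact: biconjugate_embed_le.
- apply: le_trans (biconjugate_embed_le _ _) _.
  exact: le_trans (limsup_constraint_le f x) fx.
- apply: weak_star_closure_sub; apply: le_lt_trans (biconjugate_embed_le _ _) _.
  exact: le_lt_trans fx (ltry 0).
Qed.

(* Fenchel duality for f 0 and the indicator of the feasible set, which has an
   interior point x2 in the domain of f 0. *)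
Lemma primal_le_dual (x2 : X) (d : R) :
  (forall k, convex_efun (f k)) -> (forall x, -oo < f 0%N x) -> (0 < d)%R ->
  edom (f 0%N) x2 -> (forall x, (`|x - x2| < d)%R -> sup_constraint f x <= 0) ->
  primal_value f <= dual_value f.
Proof.
move=> f_convex f0_gtNy d0 fx2 ball0.
have primal_le x : sup_constraint f x <= 0 -> primal_value f <= f 0%N x.
  move=> /(tail_sup_leP f 0%N) fx; apply: ereal_inf_lbound; exists x => //.
have x2_ball : (`|x2 - x2| < d)%R by rewrite subrr normr0.
have := le_lt_trans (primal_le _ (ball0 _ x2_ball)) fx2.
case pv : (primal_value f) => [v||] // _; last by rewrite leNye.
(* A is the zero function on the feasible set, B the hypograph of v - [f 0], with v the primal
   value. If u - c separates them, the dual objective at - u is at least v. *)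
pose A (x : X) (r : R) := sup_constraint f x <= 0 /\ r = 0%R.
pose B (x : X) (s : R) := f 0%N x <= (v - s)%:E.
have [y2 fy2] := lty_fin_ub fx2.
have [|||//|||u [c [uA uB]]] := @sandwich R X A B x2 0%R (v - y2)%R d.
- move=> x y r s t t01 [fx ->] [fy ->]; split; last by rewrite !mulr0 addr0.
  have := tail_sup_convex f_convex t01 (fx : epigraph _ x 0%R) (fy : epigraph _ y 0%R).
  by rewrite /epigraph !mulr0 addr0.
- move=> x y r s t t01 fx fy; rewrite /B.
  have -> : (v - (t * r + (1 - t) * s) = t * (v - r) + (1 - t) * (v - s))%R by ring.
  exact: (epigraph_convex (f_convex 0%N) t01 fx fy).
- move=> x _ s [/primal_le fx ->] fxs.
  by have := le_trans fx fxs; rewrite pv lee_fin lerBrDr gerDl.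
- by move=> x /ball0 fx; split.
- by rewrite /B subKr.
have conj_le : conjugate (f 0%N) (- u)%R <= (- v - c)%:E.
  apply: ge_ereal_sup => _ [x _ <-].
  have := f0_gtNy x; have := uB x; rewrite /B.
  rewrite [((- u)%R : dual X) x](_ : _ = (- u x)%R)//.
  case: (f 0%N x) => [r h _||//]; last by rewrite addeNy leNye.
  rewrite -EFinB lee_fin.
  by have := h (v - r)%R; rewrite subKr => /(_ (lexx _)) h'; lra.
have supp_le : support_fun (feasible_core f) u <= c%:E.
  apply: ge_ereal_sup => _ [x [[fx _] _] <-]; rewrite lee_fin -subr_le0.
  by apply: uA.
apply: (@le_trans _ _ (- conjugate (f 0%N) (- u)%R
  - support_fun (feasible_core f) (- - u)%R)); last first.
  by apply: ereal_sup_ubound; exists (- u)%R.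
rewrite opprK; apply: (@le_trans _ _ (- (- v - c)%:E - c%:E)).
  by rewrite -EFinN -EFinB lee_fin; lra.
by apply: leeB => //; rewrite leeN2.
Qed.

End Values.

Theorem proposition12 (R : realType) (X : completeNormedModType R)
  (f : nat -> X -> \bar R)
  (f_proper : forall k : nat, proper_fun (f k))
  (f_convex : forall k : nat, convex_efun (f k))
  (primal_lty : primal_value f < +oo)
  (slater : exists x0 : X, edom (f 0%N) x0 /\ sup_constraint f x0 < 0)
  (sup_continuous : exists x1 : X,
    [/\ edom (f 0%N) x1, sup_constraint f x1 \is a fin_num &
        {for x1, continuous (sup_constraint f)}]) :
  (* the infimum over a > 0 in (D') is a minimum *)
  (forall xs : dual X, exists2 a : R, (0 < a)%R &
     penalized_conjugate f (- xs)%R a = penalized_value f (- xs)%R) /\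
  [/\ primal_value f = dual_value f,
      dual_value f = dual'_value f &
      dual'_value f = bidual_value f].
Proof.
have [x0 [f0x0 slater_x0]] := slater.
have [x1 [f0x1 x1_fin x1_cont]] := sup_continuous.
have [M [e [e0 sup_le]]] := sup_constraint_ball x1_fin x1_cont.
have [x2 [d [d0 f0x2 ball0]]] := slater_ball f_convex e0 sup_le slater_x0 f0x0 f0x1.
(* The cycle (P) <= (D) <= bidual problem <= (P) forces equality; (D) and (D') agree slope by
   slope. *)
have PD := primal_le_dual f_convex (f_proper 0%N).1 d0 f0x2 ball0.
have DB := dual_le_bidual f_convex e0 sup_le slater_x0 x1_fin.
have BP := bidual_le_primal f.
have DD' : dual_value f = dual'_value f.
  congr ereal_sup; apply: eq_imagel => u _ /=.
  by rewrite (penalized_valueE f_convex e0 sup_le slater_x0).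
split.
  move=> u; have [a a0 ha] :=
    penalized_attained f_convex e0 sup_le slater_x0 (- u)%R.
  by exists a => //; rewrite ha (penalized_valueE f_convex e0 sup_le slater_x0).
split=> //; first by apply/eqP; rewrite eq_le PD (le_trans DB BP).
by rewrite -DD'; apply/eqP; rewrite eq_le DB (le_trans BP PD).
Qed.
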